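(* Let $\mathbf A$ be a non-idempotent finitely subdirectly irreducible De Morgan monoid, and let $G=[\neg(f^2))=\{a\in A:\neg(f^2)\leqslant a\}$. Then $G$ is a deductive filter, $\mathbf A/G$ is a totally ordered odd Sugihara monoid, the class $e/G$ is the interval $[\neg(f^2),f^2]$, and $a/G=\{a\}$ for every $a\in A\setminus[\neg(f^2),f^2]$.
   Context: An involutive residuated lattice (IRL) is an algebra $\langle A;\cdot,\wedge,\vee,\neg,e\rangle$ with $\langle A;\cdot,e\rangle$ a commutative monoid, $\langle A;\wedge,\vee\rangle$ a lattice, $\neg\neg x=x$, and $x\cdot y\leqslant z\iff\neg z\cdot y\leqslant\neg x$. Define $x\to y:=\neg(x\cdot\neg y)$, $f:=\neg e$, $f^2:=f\cdot f$. A De Morgan monoid is an IRL with distributive lattice satisfying $x\leqslant x\cdot x$; it is idempotent if $a\cdot a=a$ for all $a$. A Sugihara monoid is an idempotent De Morgan monoid; it is odd if $f=e$. An algebra is finitely subdirectly irreducible (FSI) if its identity congruence is meet-irreducible in its congruence lattice. A deductive filter is a lattice filter containing $e$ and closed under $\cdot$; for a deductive filter $G$, $\mathbf A/G$ denotes the quotient by the congruence $\{\langle a,b\rangle: a\to b,\ b\to a\in G\}$, and $a/G$ the class of $a$. $[a,b]=\{x:a\leqslant x\leqslant b\}$. *)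

(* Defs.v *)
From HB Require Import structures.
From mathcomp Require Export all_boot all_order.
From mathcomp Require Export monoid generic_quotient interval.
From mathcomp Require Export boolp classical_sets set_interval.

Set Implicit Arguments.
Unset Strict Implicit.
Unset Printing Implicit Defensive.

Import Order.LTheory.

Local Open Scope group_scope.
Local Open Scope order_scope.

(* The order of an IRL is that of its lattice reduct, the unit e is [1%g] and
   the product is [( * )%g].  A carrier with a choice operator is no restriction
   in the classical setting. *)
HB.mixin Record isInvolutiveResiduated d A of Order.Lattice d A & Monoid A := {
  neg : A -> A;
  mulIC : @commutative A A *%g;
  negK : involutive neg;
  residuation : forall x y z : A, (x * y <= z) = (neg z * y <= neg x)
}.

#[short(type="irlType")]
HB.structure Definition IRL d :=
  {A of isInvolutiveResiduated d A & Order.Lattice d A & Monoid A}.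

Definition imp (d : Order.disp_t) (A : irlType d) (x y : A) : A :=
  neg (x * neg y).

Definition falsum (d : Order.disp_t) (A : irlType d) : A := neg 1.
Arguments falsum {d A}.

Section Predicates.
Context (d : Order.disp_t).

Definition idempotent_irl (A : irlType d) : Prop := forall a : A, a * a = a.

Definition de_morgan_monoid (A : irlType d) : Prop :=
  @left_distributive A A Order.meet Order.join /\ forall x : A, x <= x * x.

Definition sugihara_monoid (A : irlType d) : Prop :=
  de_morgan_monoid A /\ idempotent_irl A.

Definition odd_irl (A : irlType d) : Prop := falsum = 1 :> A.

Definition totally_ordered (A : irlType d) : Prop :=
  total (<=%O : rel A).

Record congruence (A : irlType d) (R : A -> A -> Prop) : Prop := Congruence {
  cong_refl : forall a, R a a;
  cong_sym : forall a b, R a b -> R b a;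
  cong_trans : forall a b c, R a b -> R b c -> R a c;
  cong_mul : forall a a' b b', R a a' -> R b b' -> R (a * b) (a' * b');
  cong_meet : forall a a' b b', R a a' -> R b b' -> R (a `&` b) (a' `&` b');
  cong_join : forall a a' b b', R a a' -> R b b' -> R (a `|` b) (a' `|` b');
  cong_neg : forall a a', R a a' -> R (neg a) (neg a')
}.

(* Meets in the congruence lattice are intersections, and the identity
   congruence is Leibniz equality. *)
Definition fsi (A : irlType d) : Prop :=
  forall R S : A -> A -> Prop, congruence R -> congruence S ->
    (fun a b => R a b /\ S a b) = eq -> R = eq \/ S = eq.

Record deductive_filter (A : irlType d) (G : set A) : Prop := DeductiveFilter {
  dfilter_up : forall a b, G a -> a <= b -> G b;
  dfilter_meet : forall a b, G a -> G b -> G (a `&` b);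
  dfilter_one : G 1;
  dfilter_mul : forall a b, G a -> G b -> G (a * b)
}.

Definition filter_rel (A : irlType d) (G : set A) (a b : A) : Prop :=
  G (imp a b) /\ G (imp b a).

Definition class_mod (A : irlType d) (G : set A) (a : A) : set A :=
  [set b | filter_rel G a b]%classic.

End Predicates.

Section IRLTheory.
Context (d : Order.disp_t) (A : irlType d).
Implicit Types x y z : A.

Lemma leN x y : (neg y <= neg x) = (x <= y).
Proof. by rewrite -[x in RHS]mulg1 residuation mulg1. Qed.

Lemma le_imp x y z : (x * y <= z) = (x <= imp y z).
Proof. by rewrite residuation mulIC /imp -[x in RHS]negK leN. Qed.

Lemma mul_le x x' y : x <= x' -> x * y <= x' * y.
Proof. by move=> h; rewrite le_imp (le_trans h)// -le_imp. Qed.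

Lemma imp_mul x y : imp x y * x <= y.
Proof. by rewrite le_imp. Qed.

Lemma negI x y : neg (x `&` y) = neg x `|` neg y.
Proof.
apply/le_anti/andP; split.
  by rewrite -leN negK lexI -(leN (neg _) x) -(leN (neg _) y) !negK leUl leUr.
by rewrite leUx !leN leIl leIr.
Qed.

Lemma negU x y : neg (x `|` y) = neg x `&` neg y.
Proof. by rewrite -[RHS]negK negI !negK. Qed.

Lemma imp_neg x y : imp (neg y) (neg x) = imp x y.
Proof. by rewrite /imp negK mulIC. Qed.

Lemma le1_imp x y : x <= y -> 1 <= imp x y.
Proof. by rewrite -le_imp mul1g. Qed.

Lemma imp_trans_le x y z : imp x y * imp y z <= imp x z.
Proof.
rewrite -le_imp (mulIC (imp x y)) -mulgA.
apply: le_trans (imp_mul y z).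
by rewrite ![imp y z * _]mulIC mul_le// imp_mul.
Qed.

Lemma imp_mulr x y z : imp x y <= imp (x * z) (y * z).
Proof. by rewrite -le_imp mulgA mul_le// imp_mul. Qed.

Lemma imp_meetr x y z : imp x y `&` 1 <= imp (x `&` z) (y `&` z).
Proof.
rewrite -le_imp lexI; apply/andP; split.
  apply: le_trans (imp_mul x y); apply: (@le_trans _ _ (imp x y * (x `&` z))).
    by rewrite mul_le// leIl.
  by rewrite ![imp x y * _]mulIC mul_le// leIl.
apply: (@le_trans _ _ (1 * (x `&` z))); first by rewrite mul_le// leIr.
by rewrite mul1g leIr.
Qed.

Lemma filter_congruence (G : set A) :
  deductive_filter G -> congruence (filter_rel G).
Proof.
case=> up cap G1 Gmul.
have refl a : filter_rel G a a by split; apply: up G1 _; rewrite le1_imp.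
have sym a b : filter_rel G a b -> filter_rel G b a by case; split.
have trans a b c : filter_rel G a b -> filter_rel G b c -> filter_rel G a c.
  move=> [ab ba] [bc cb].
  by split; [exact: up (Gmul _ _ ab bc) (imp_trans_le _ _ _)
            |exact: up (Gmul _ _ cb ba) (imp_trans_le _ _ _)].
have mulr a a' c : filter_rel G a a' -> filter_rel G (a * c) (a' * c).
  by move=> [h k]; split; [exact: up h (imp_mulr _ _ _)
                          |exact: up k (imp_mulr _ _ _)].
have meetr a a' c : filter_rel G a a' -> filter_rel G (a `&` c) (a' `&` c).
  by move=> [h k]; split; [exact: up (cap _ _ h G1) (imp_meetr _ _ _)
                          |exact: up (cap _ _ k G1) (imp_meetr _ _ _)].
have ng a a' : filter_rel G a a' -> filter_rel G (neg a) (neg a').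
  by move=> [h k]; split; rewrite imp_neg.
have meet a a' b b' : filter_rel G a a' -> filter_rel G b b' ->
    filter_rel G (a `&` b) (a' `&` b').
  move=> ha hb; apply: (@trans _ (a' `&` b)); first exact: meetr.
  by rewrite ![a' `&` _]meetC; apply: meetr.
split=> //.
- move=> a a' b b' ha hb; apply: (@trans _ (a' * b)); first exact: mulr.
  by rewrite ![a' * _]mulIC; apply: mulr.
- move=> a a' b b' ha hb; rewrite -[a `|` b]negK -[a' `|` b']negK !negU.
  by apply/ng/meet; apply: ng.
Qed.

End IRLTheory.

Section Quotient.
Context (d : Order.disp_t) (A : irlType d) (R : A -> A -> Prop).
Hypothesis congR : congruence R.

Definition cong_rel : rel A := fun a b => `[< R a b >].

Fact cong_rel_refl : reflexive cong_rel.
Proof. by move=> a; apply/asboolP; apply: cong_refl. Qed.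

Fact cong_rel_sym : symmetric cong_rel.
Proof. by move=> a b; apply/asboolP/asboolP; apply: cong_sym. Qed.

Fact cong_rel_trans : transitive cong_rel.
Proof.
move=> b a c /asboolP h /asboolP k.
by apply/asboolP; apply: cong_trans h k.
Qed.

Definition cong_equiv := EquivRel cong_rel cong_rel_refl cong_rel_sym cong_rel_trans.

Definition quot := {eq_quot cong_equiv}%qT.
HB.instance Definition _ := Choice.on quot.
HB.instance Definition _ := Quotient.on quot.

Local Notation "[q a ]" := (\pi_quot a)%qT.

Lemma quot_eqP a b : [q a] = [q b] <-> R a b.
Proof.
split; first by move/eqmodP/asboolP.
by move=> h; apply/eqmodP/asboolP.
Qed.

Definition quot_mul (x y : quot) : quot := [q repr x * repr y].
Definition quot_one : quot := [q 1].
Definition quot_neg (x : quot) : quot := [q neg (repr x)].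
Definition quot_meet (x y : quot) : quot := [q repr x `&` repr y].
Definition quot_join (x y : quot) : quot := [q repr x `|` repr y].
Definition quot_le (x y : quot) : bool := quot_meet x y == x.

Lemma repr_pi a : R (repr [q a]) a.
Proof. by apply/quot_eqP; rewrite reprK. Qed.

Lemma quot_mulE a b : quot_mul [q a] [q b] = [q a * b].
Proof. by apply/quot_eqP; apply: (cong_mul congR); exact: repr_pi. Qed.

Lemma quot_negE a : quot_neg [q a] = [q neg a].
Proof. by apply/quot_eqP; apply: (cong_neg congR); exact: repr_pi. Qed.

Lemma quot_meetE a b : quot_meet [q a] [q b] = [q a `&` b].
Proof. by apply/quot_eqP; apply: (cong_meet congR); exact: repr_pi. Qed.

Lemma quot_joinE a b : quot_join [q a] [q b] = [q a `|` b].
Proof. by apply/quot_eqP; apply: (cong_join congR); exact: repr_pi. Qed.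

Lemma quotW (P : quot -> Prop) : (forall a, P [q a]) -> forall x, P x.
Proof. by move=> h x; rewrite -[x]reprK; apply: h. Qed.

Definition quotE := (quot_mulE, quot_negE, quot_meetE, quot_joinE).

Fact quot_mulA : associative quot_mul.
Proof.
by elim/quotW=> a; elim/quotW=> b; elim/quotW=> c; rewrite !quotE mulgA.
Qed.

Fact quot_mulC : commutative quot_mul.
Proof. by elim/quotW=> a; elim/quotW=> b; rewrite !quotE mulIC. Qed.

Fact quot_mul1 : left_id quot_one quot_mul.
Proof. by elim/quotW=> a; rewrite !quotE mul1g. Qed.

Fact quot_mulr1 : right_id quot_one quot_mul.
Proof. by elim/quotW=> a; rewrite !quotE mulg1. Qed.

Fact quot_negK : involutive quot_neg.
Proof. by elim/quotW=> a; rewrite !quotE negK. Qed.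

Fact quot_meetC : commutative quot_meet.
Proof. by elim/quotW=> a; elim/quotW=> b; rewrite !quotE meetC. Qed.

Fact quot_joinC : commutative quot_join.
Proof. by elim/quotW=> a; elim/quotW=> b; rewrite !quotE joinC. Qed.

Fact quot_meetA : associative quot_meet.
Proof.
by elim/quotW=> a; elim/quotW=> b; elim/quotW=> c; rewrite !quotE meetA.
Qed.

Fact quot_joinA : associative quot_join.
Proof.
by elim/quotW=> a; elim/quotW=> b; elim/quotW=> c; rewrite !quotE joinA.
Qed.

Fact quot_joinKI y x : quot_meet x (quot_join x y) = x.
Proof. by elim/quotW: y=> b; elim/quotW: x=> a; rewrite !quotE joinKI. Qed.

Fact quot_meetKU y x : quot_join x (quot_meet x y) = x.
Proof. by elim/quotW: y=> b; elim/quotW: x=> a; rewrite !quotE meetKU. Qed.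

Fact quot_le_refl : reflexive quot_le.
Proof. by elim/quotW=> a; rewrite /quot_le !quotE meetxx. Qed.

Fact quot_le_anti : antisymmetric quot_le.
Proof.
by move=> x y /andP[/eqP h /eqP k]; rewrite -h quot_meetC k.
Qed.

Fact quot_le_trans : transitive quot_le.
Proof.
by move=> y x z /eqP h /eqP k; apply/eqP; rewrite -h -quot_meetA k.
Qed.

HB.instance Definition _ :=
  isMonoid.Build quot quot_mulA quot_mul1 quot_mulr1.
HB.instance Definition _ :=
  Order.Le_isPOrder.Build d quot quot_le_refl quot_le_anti quot_le_trans.
HB.instance Definition _ :=
  Order.POrder_isLattice.Build d quot quot_meetC quot_joinC
    quot_meetA quot_joinA quot_joinKI quot_meetKU (fun _ _ => erefl).

Lemma quot_leE a b : ([q a] <= [q b]) = ([q a `&` b] == [q a]).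
Proof. by rewrite -quot_meetE. Qed.

Lemma quot_leW a b : a <= b -> [q a] <= [q b].
Proof. by move=> /meet_idPl h; rewrite quot_leE h. Qed.

Lemma quot_leN (x y : quot) : x <= y -> quot_neg y <= quot_neg x.
Proof.
elim/quotW: x => a; elim/quotW: y => b; rewrite quot_leE => /eqP h.
by rewrite -h !quot_negE quot_leW// leN leIr.
Qed.

Lemma quot_mul_le (x y z : quot) : x <= y -> quot_mul x z <= quot_mul y z.
Proof.
elim/quotW: x => a; elim/quotW: y => b; elim/quotW: z => c.
by rewrite quot_leE => /eqP <-; rewrite !quotE quot_leW// mul_le// leIr.
Qed.

Fact quot_residuationW (x y z : quot) :
  x * y <= z -> quot_neg z * y <= quot_neg x.
Proof.
move=> /quot_leN /(@quot_mul_le _ _ y) /le_trans; apply.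
elim/quotW: x => a; elim/quotW: y => b; rewrite [[q a] * _]quot_mulE !quotE.
by apply: quot_leW; rewrite -residuation.
Qed.

Fact quot_residuation (x y z : quot) :
  (x * y <= z) = (quot_neg z * y <= quot_neg x).
Proof.
apply/idP/idP; first exact: quot_residuationW.
by move/quot_residuationW; rewrite !quot_negK.
Qed.

HB.instance Definition _ :=
  isInvolutiveResiduated.Build d quot quot_mulC quot_negK quot_residuation.

End Quotient.

Definition filter_quot (d : Order.disp_t) (A : irlType d) (G : set A)
    (hG : deductive_filter G) : irlType d :=
  quot (filter_congruence hG).

(* Main.v *)
Require Import Defs.

Set Implicit Arguments.
Unset Strict Implicit.
Unset Printing Implicit Defensive.

Import Order.LTheory.

Local Open Scope classical_set_scope.
Local Open Scope group_scope.
Local Open Scope order_scope.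

(** Write [g := ¬(f²) = f → e] and [t := f²].  Finite subdirect irreducibility
    makes [e] prime in [e <= x ∨ ¬x], so every [x] satisfies [e <= x] or
    [x <= f]; non-idempotence means that [f <= e] fails, whence [g <= e <= t] and
    [g <= f <= t].  Moreover [f³ = f²] and [t g = g], so [G = [g)] is a deductive
    filter and [b], [c] are congruent iff [g b = g c].  Outside [[g, t]],
    multiplication by [g] is the identity: if [e <= b] and [b] is not below [t],
    then [e <= g b], hence [t <= b], which forces [b] to be idempotent and
    [b <= g b b = g b]; the remaining case is dual.  For totality, if neither
    [x → y] nor [y → x] is in [G], then [u = x ¬y] and [v = y ¬x] lie above [e],
    and [u <= u v <= f²] contradicts [x → y = ¬u] not being in [G]. *)

(** * Residuation and negation *)

Section InvolutiveResiduated.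
Context (d : Order.disp_t) (A : irlType d).
Implicit Types x y z : A.

Lemma mul_le2 x x' y y' : x <= x' -> y <= y' -> x * y <= x' * y'.
Proof.
move=> hx hy; apply: le_trans (mul_le y hx) _.
by rewrite ![x' * _]mulIC mul_le.
Qed.

Lemma neg_le x y : (neg x <= y) = (neg y <= x).
Proof. by rewrite -leN negK. Qed.

Lemma imp1x x : imp 1 x = x.
Proof. by rewrite /imp mul1g negK. Qed.

Lemma impx_falsum x : imp x falsum = neg x.
Proof. by rewrite /imp /falsum negK mulg1. Qed.

Lemma mul_neg_falsum x : x * neg x <= falsum.
Proof. by rewrite mulIC le_imp impx_falsum. Qed.

Lemma falsum_imp1 : imp falsum 1 = neg (falsum * falsum) :> A.
Proof. by []. Qed.

Lemma le_imp1E x y : (1 <= imp x y) = (x <= y).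
Proof. by rewrite -le_imp mul1g. Qed.

Lemma leN_falsum x : (1 <= neg x) = (x <= falsum).
Proof. by rewrite -impx_falsum le_imp1E. Qed.

End InvolutiveResiduated.

(** * The square-increasing law: bounds on products of [f], [t], [g] *)

Section SquareIncreasing.
Context (d : Order.disp_t) (A : irlType d).
Hypothesis sq_inc : forall x : A, x <= x * x.
Implicit Types x y z : A.

Local Notation f := (falsum : A).
Local Notation t := (falsum * falsum : A).
Local Notation g := (neg (falsum * falsum) : A).

Lemma le1_sq x : x <= 1 -> x * x = x.
Proof.
move=> h; apply/le_anti; rewrite sq_inc andbT.
by rewrite -[leRHS]mul1g mul_le.
Qed.

Lemma principal_deductive_filter x :
  x <= 1 -> deductive_filter [set y : A | x <= y].
Proof.
move=> hx; split=> //=.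
- by move=> a b ha; exact: le_trans.
- by move=> a b ha hb; rewrite lexI ha.
- by move=> a b ha hb; rewrite -(le1_sq hx) mul_le2.
Qed.

(** Residuation turns [x * x <= x] into [neg x * x <= neg x]; duplicating [neg x] leaves a spare
    factor [neg x * x <= f <= 1]. *)
Lemma idempotent_of_falsum_le1 : f <= 1 -> idempotent_irl A.
Proof.
move=> hf x; apply/le_anti; rewrite sq_inc andbT.
rewrite residuation; apply: (@le_trans _ _ (neg x * (neg x * x))).
  by rewrite mulgA mul_le.
rewrite -[leRHS]mulg1 mul_le2//.
by rewrite mulIC (le_trans (mul_neg_falsum x)).
Qed.

Lemma falsum_le_sq : f <= t.
Proof. exact: sq_inc. Qed.

Lemma neg_falsum_sq_le1 : g <= 1.
Proof. by rewrite neg_le falsum_le_sq. Qed.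

Lemma neg_falsum_sq_idem : g * g = g.
Proof. exact/le1_sq/neg_falsum_sq_le1. Qed.

(** As [g] is [imp f 1], the claim reads [g * f * f <= 1]; idempotence of [g] makes the left side
    the square of [g * f <= 1]. *)
Lemma falsum_mul_neg_sq : f * g <= g.
Proof.
have fg1 : g * f <= 1 by rewrite le_imp falsum_imp1.
rewrite -{2}falsum_imp1 -le_imp (mulIC f) -mulgA.
have ->: g * (f * f) = (g * f) * (g * f).
  rewrite (mulIC g (f * f)) -{1}neg_falsum_sq_idem.
  by rewrite -!mulgA (mulgA f g) (mulIC f g) -!mulgA (mulIC f) !mulgA.
by rewrite -[leRHS]mul1g mul_le2.
Qed.

Lemma falsum_sq_mul_neg_sq : t * g <= g.
Proof.
rewrite -mulgA (le_trans _ falsum_mul_neg_sq)// mul_le2//.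
exact: falsum_mul_neg_sq.
Qed.

Lemma falsum_cube_le : f * t <= t.
Proof.
by rewrite mulIC residuation mulIC falsum_mul_neg_sq.
Qed.

End SquareIncreasing.

(** * Finite subdirect irreducibility and the classes modulo [G] *)

Section FSIDeMorgan.
Context (d : Order.disp_t) (A : irlType d).
Hypotheses (hDM : de_morgan_monoid A) (hnon : ~ idempotent_irl A) (hfsi : fsi A).
Implicit Types x y z b : A.

Local Notation f := (falsum : A).
Local Notation t := (falsum * falsum : A).
Local Notation g := (neg (falsum * falsum) : A).

Let sq_inc : forall x : A, x <= x * x := hDM.2.

(** The congruences of the filters generated by x ∧ 1 and y ∧ 1 intersect in equality, since
    distributivity gives (x ∧ 1) ∨ (y ∧ 1) = 1. One of them is thus equality, and it identifies its
    generator with 1. *)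
Lemma one_join_prime x y : 1 <= x `|` y -> 1 <= x \/ 1 <= y.
Proof.
have hF z := principal_deductive_filter sq_inc (leIr 1 z).
have hE z : filter_rel [set w : A | z `&` 1 <= w] = eq -> 1 <= z.
  move=> h; have: filter_rel [set w : A | z `&` 1 <= w] 1 (z `&` 1).
    split=> /=; first by rewrite imp1x.
    by apply: le_trans (leIr _ _) _; rewrite le_imp1E leIr.
  by rewrite h => ->; exact: leIl.
move=> hxy.
have le_of a b : x `&` 1 <= imp a b -> y `&` 1 <= imp a b -> a <= b.
  move=> ha hb; rewrite -le_imp1E.
  have <-: (x `|` y) `&` 1 = 1 by apply/meet_idPr.
  by rewrite hDM.1 leUx ha hb.
have [|h|h] := hfsi (filter_congruence (hF x)) (filter_congruence (hF y)).
- apply/funext => a; apply/funext => b; apply/propext; split.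
    by move=> [[? ?] [? ?]]; apply/le_anti/andP; split; apply: le_of.
  by move=> <-; split; apply: (cong_refl (filter_congruence (hF _))).
- by left; apply: hE.
- by right; apply: hE.
Qed.

Lemma ge1_or_le_falsum x : 1 <= x \/ x <= f.
Proof.
rewrite -leN_falsum; apply: one_join_prime.
rewrite -[x in x `|` _]negK -negI leN_falsum.
apply: le_trans (sq_inc _) _; apply: le_trans (mul_neg_falsum (neg x)).
by rewrite negK mul_le2// (leIl, leIr).
Qed.

Lemma falsum_nle1 : ~ f <= 1.
Proof. by move=> /(idempotent_of_falsum_le1 sq_inc). Qed.

Lemma neg_falsum_sq_le_falsum : g <= f.
Proof.
have [|//] := ge1_or_le_falsum g.
by rewrite -falsum_imp1 le_imp1E => /falsum_nle1.
Qed.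

Lemma falsum_mul_le_neg_falsum_sq b : b <= g -> f * b <= b.
Proof.
move=> hb; apply: (@le_trans _ _ (f * b * b)).
  by rewrite -mulgA mul_le2.
rewrite -[leRHS]mul1g mul_le// (le_trans _ (neg_falsum_sq_le1 sq_inc))//.
by apply: le_trans (falsum_mul_neg_sq sq_inc); rewrite mul_le2.
Qed.

(** In residuated form, [neg b * b <= neg b]: duplicating [neg b] bounds the left side by
    [f * neg b], and [f] is absorbed because [neg b <= g]. *)
Lemma falsum_sq_ge_idem b : t <= b -> b * b = b.
Proof.
move=> htb; apply/le_anti; rewrite sq_inc andbT residuation.
apply: (@le_trans _ _ (f * neg b)); last first.
  by apply: falsum_mul_le_neg_falsum_sq; rewrite leN.
apply: (@le_trans _ _ ((neg b * neg b) * b)); first by rewrite mul_le.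
by rewrite -mulgA mulIC mul_le// mulIC mul_neg_falsum.
Qed.

Lemma neg_falsum_sq_mul_le b : g * b <= b.
Proof. by rewrite -[leRHS]mul1g mul_le// neg_falsum_sq_le1. Qed.

Lemma neg_falsum_sq_mul_ge1 b : 1 <= b -> ~ b <= t -> g * b = b.
Proof.
move=> h1b hbt; apply/le_anti; rewrite neg_falsum_sq_mul_le /=.
(* The alternative [g * b <= f] would give [b <= neg g = t]. *)
have [h1|] := ge1_or_le_falsum (g * b); last first.
  by rewrite mulIC le_imp impx_falsum negK => /hbt.
have htb : t <= b.
  apply: le_trans (neg_falsum_sq_mul_le b).
  apply: (@le_trans _ _ (t * (g * b))); first by rewrite -[leLHS]mulg1 mul_le2.
  by rewrite mulgA mul_le// falsum_sq_mul_neg_sq.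
by rewrite -[b in g * b]falsum_sq_ge_idem// mulgA -[leLHS]mul1g mul_le.
Qed.

Lemma neg_falsum_sq_mul b : ~ `[g, t]%classic b -> g * b = b.
Proof.
rewrite set_itvE /= => hb.
have [h1b|hbf] := ge1_or_le_falsum b.
  apply: neg_falsum_sq_mul_ge1 => // hbt; apply: hb.
  by rewrite hbt (le_trans (neg_falsum_sq_le1 sq_inc)).
have hgb : ~ g <= b.
  by move=> h; apply: hb; rewrite h (le_trans hbf)// falsum_le_sq.
apply/le_anti; rewrite neg_falsum_sq_mul_le /= -leN.
(* The previous lemma, applied to [neg (g * b)] rather than [neg b], replaces it by
   [g * neg (g * b)], which residuation puts below [neg b]. *)
rewrite -[leLHS]neg_falsum_sq_mul_ge1.
- by rewrite mulIC residuation !negK mulIC.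
- by rewrite leN_falsum (le_trans (neg_falsum_sq_mul_le b)).
- move=> h; apply: hgb; apply: le_trans (neg_falsum_sq_mul_le b).
  by rewrite neg_le.
Qed.

Lemma neg_falsum_sq_imp_total x y : g <= imp x y \/ g <= imp y x.
Proof.
rewrite /imp !leN.
have [|/negP hu] := boolP (x * neg y <= t); first by left.
have [|/negP hv] := boolP (y * neg x <= t); first by right.
have [hv1|/le_trans hv1] := ge1_or_le_falsum (y * neg x); last first.
  by case: hv; apply: hv1; exact: falsum_le_sq.
case: hu; apply: (@le_trans _ _ ((x * neg y) * (y * neg x))).
  by rewrite -[leLHS]mulg1 mul_le2.
have ->: (x * neg y) * (y * neg x) = (x * neg x) * (y * neg y).
  by rewrite -mulgA (mulgA (neg y)) (mulIC (neg y * y)) mulgA (mulIC (neg y)).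
by rewrite mul_le2// mul_neg_falsum.
Qed.

(** The left side means [b * f <= t]. It follows from [b <= t] by [f * t <= t]; conversely it gives
    [b * f * g <= t * g <= 1], so [b * g <= g <= f], which is [b <= t]. *)
Lemma neg_falsum_sq_le_imp1 b : (g <= imp b 1) = (b <= t).
Proof.
rewrite leN -/f; apply/idP/idP => h.
  rewrite -[leRHS]negK -impx_falsum -le_imp.
  apply: le_trans neg_falsum_sq_le_falsum.
  rewrite -falsum_imp1 -le_imp -mulgA (mulIC g) mulgA.
  apply: le_trans (neg_falsum_sq_le1 sq_inc).
  by apply: le_trans (falsum_sq_mul_neg_sq sq_inc); rewrite mul_le.
by rewrite mulIC (le_trans _ (falsum_cube_le sq_inc))// mul_le2.
Qed.

Lemma class_mod_one : class_mod [set a : A | g <= a] 1 = `[g, t]%classic.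
Proof.
rewrite set_itvE; apply/seteqP; split=> b;
  rewrite /class_mod /filter_rel /= imp1x neg_falsum_sq_le_imp1.
  by move=> [-> ->].
by move=> /andP[].
Qed.

Lemma class_mod_outside a :
  ~ `[g, t]%classic a -> class_mod [set a : A | g <= a] a = [set a].
Proof.
move=> ha.
have congG := filter_congruence
  (principal_deductive_filter sq_inc (neg_falsum_sq_le1 sq_inc)).
apply/seteqP; split=> b /=; last by move=> ->; exact: (cong_refl congG).
(* The interval is the class of 1, so [b] lies outside it along with [a]; [g] then acts as the
   identity on both. *)
move=> hab; have hb : ~ `[g, t]%classic b.
  rewrite -class_mod_one => h1b; apply: ha; rewrite -class_mod_one.
  exact: (cong_trans congG) h1b (cong_sym congG hab).
case: hab; rewrite /= -!le_imp !neg_falsum_sq_mul// => hab hba.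
by apply/le_anti; rewrite hab hba.
Qed.

End FSIDeMorgan.

(** * Transfer to the quotient *)

Lemma quot_de_morgan (d : Order.disp_t) (A : irlType d) (R : A -> A -> Prop)
  (congR : congruence R) : de_morgan_monoid A -> de_morgan_monoid (quot congR).
Proof.
move=> [dist sq]; split; last first.
  elim/quotW=> a; rewrite [_ * _]quot_mulE; exact: quot_leW.
elim/quotW=> a; elim/quotW=> b; elim/quotW=> c.
by rewrite /Order.meet /Order.join /= !quotE dist.
Qed.

Lemma filter_quot_le (d : Order.disp_t) (A : irlType d) (G : set A)
  (hG : deductive_filter G) (a b : A) : G (imp a b) ->
  (\pi_(quot (filter_congruence hG)) a <= \pi_(quot (filter_congruence hG)) b)%qT.
Proof.
move=> hab; rewrite quot_leE; apply/eqP/quot_eqP; split.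
  by apply: dfilter_up (dfilter_one hG) _ => //; rewrite le_imp1E leIl.
apply: (dfilter_up hG (dfilter_meet hG hab (dfilter_one hG))).
rewrite -le_imp lexI; apply/andP; split.
  by rewrite -[leRHS]mul1g mul_le// leIr.
by rewrite (le_trans _ (imp_mul a b))// mul_le// leIl.
Qed.

Theorem theorem7p16 (d : Order.disp_t) (A : irlType d)
    (hDM : de_morgan_monoid A) (hnon : ~ idempotent_irl A) (hfsi : fsi A) :
  let f2 : A := falsum * falsum in
  let G : set A := [set a : A | neg f2 <= a]%classic in
  exists hG : deductive_filter G,
    [/\ totally_ordered (filter_quot hG),
        sugihara_monoid (filter_quot hG) /\ odd_irl (filter_quot hG),
        class_mod G 1 = `[neg f2, f2]%classic
      & forall a : A, ~ `[neg f2, f2]%classic a -> class_mod G a = [set a]%classic].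
Proof.
move=> f2 G; have sq := hDM.2.
have hG : deductive_filter G := principal_deductive_filter sq (neg_falsum_sq_le1 sq).
have hodd : odd_irl (filter_quot hG).
  (* [f] and 1 are congruent: [imp f 1] is [g] itself, and [imp 1 f = f] is above [g]. *)
  rewrite /odd_irl /falsum; apply: etrans (quot_negE _ _) _.
  apply/quot_eqP; split; first exact: lexx.
  by rewrite /= imp1x; exact: neg_falsum_sq_le_falsum.
have hDMq : de_morgan_monoid (filter_quot hG) by exact: quot_de_morgan.
exists hG; split.
- elim/quotW=> a; elim/quotW=> b; apply/orP.
  by case: (neg_falsum_sq_imp_total hDM hfsi a b) => h; [left|right];
    apply: filter_quot_le.
(* Oddness supplies [f <= 1] in the quotient, which forces idempotence. *)
- split=> //; split=> //; apply: idempotent_of_falsum_le1 hDMq.2 _.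
  by rewrite hodd.
- exact: class_mod_one.
- exact: class_mod_outside.
Qed.
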